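(* Let $G$ be a chordal graph with a tree representation $(T_0,\mathcal F)$, $\mathcal F=\{F_v: v\in V(G)\}$, in which $T_0$ has the minimum possible number of vertices, and let $I$ be an independent set of $G$ chosen as described in the context. Then for every vertex $v$ of $G$, the tree $F_v$ contains a substantial vertex.
   Context: A tree representation of a graph $G$ is a tree $T_0$ together with a family $\mathcal F=\{F_v : v\in V(G)\}$ of subtrees of $T_0$ such that for distinct $u,v$, $uv\in E(G)$ iff $F_u$ and $F_v$ share a vertex; every chordal graph has one. Fix such a representation with $|V(T_0)|$ minimum. Choose an independent set $I$ of $G$ that is maximal with the property that for each $v\in I$, $F_v$ is a path all of whose vertices have degree at most $2$ in $T_0$; moreover $I$ is chosen such that for every $v\in I$, $F_v$ contains no member of $\mathcal F$ as a proper subgraph. For $v\in I$, $F_v$ is called an $I$-path (trivial if it has a single vertex, which is then its endvertex). A vertex of $T_0$ is substantial if it is an endvertex of some $I$-path or has degree at least $3$ in $T_0$. *)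

(* Defs.v *)
From mathcomp Require Import all_boot.

Set Implicit Arguments.
Unset Strict Implicit.
Unset Printing Implicit Defensive.

(* A finite simple graph whose vertices form a subset of an ambient finType, so
   that the host tree and its subtrees are objects of the same type. *)
Record graph (T : finType) := Graph {
  vertices : {set T};
  adj : rel T;
  adj_sym : symmetric adj;
  adj_irrefl : irreflexive adj;
  adj_vertices : forall x y, adj x y -> x \in vertices
}.

Section Graphs.
Variable T : finType.
Implicit Types G H K : graph T.

Definition degree H (x : T) : nat := #|[set y | adj H x y]|.

Definition subgraph H K : Prop :=
  vertices H \subset vertices K /\ subrel (adj H) (adj K).

Definition proper_subgraph H K : Prop := subgraph H K /\ ~ subgraph K H.

Definition connected_graph H : Prop :=
  vertices H != set0 /\ {in vertices H &, forall x y, connect (adj H) x y}.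

(* [ucycle] also holds of the empty list and of the two ends of an edge, hence
   the bound on the size. *)
Definition acyclic H : Prop :=
  forall c : seq T, ucycle (adj H) c -> size c < 3.

Definition is_tree H : Prop := connected_graph H /\ acyclic H.

Definition chordal G : Prop :=
  forall c : seq T, ucycle (adj G) c -> 3 < size c ->
  exists x y : T,
    [/\ x \in c, y \in c, adj G x y, y != next c x & x != next c y].

Definition independent G (I : {set T}) : Prop :=
  I \subset vertices G /\ {in I &, forall u v, ~~ adj G u v}.

(* H is the path with successive vertices x :: p; [zip (x :: p) p] lists the
   pairs of consecutive vertices. *)
Definition path_along H (x : T) (p : seq T) : Prop :=
  [/\ uniq (x :: p),
      vertices H =i x :: p
    & forall y z, adj H y z =
        ((y, z) \in zip (x :: p) p) || ((z, y) \in zip (x :: p) p)].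

Definition is_path H : Prop := exists x p, path_along H x p.

(* For a single-vertex path, x = last x [::] is the endvertex. *)
Definition endvertex H (z : T) : Prop :=
  exists x p, path_along H x p /\ (z = x \/ z = last x p).

End Graphs.

(* Only the values of F on the vertices of G matter. *)
Definition tree_representation (V T : finType) (G : graph V)
    (T0 : graph T) (F : V -> graph T) : Prop :=
  [/\ is_tree T0,
      {in vertices G, forall v, is_tree (F v) /\ subgraph (F v) T0}
    & {in vertices G &, forall u v, u != v ->
        (adj G u v <-> exists x, x \in vertices (F u) /\ x \in vertices (F v))}].

Definition minimum_tree_representation (V T : finType) (G : graph V)
    (T0 : graph T) (F : V -> graph T) : Prop :=
  tree_representation G T0 F /\
  forall (T' : finType) (T0' : graph T') (F' : V -> graph T'),
    tree_representation G T0' F' -> #|vertices T0| <= #|vertices T0'|.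

Section IPaths.
Variables (V T : finType) (G : graph V) (T0 : graph T) (F : V -> graph T).

Definition low_degree_path (v : V) : Prop :=
  is_path (F v) /\ {in vertices (F v), forall x, degree T0 x <= 2}.

Definition low_degree_path_independent (I : {set V}) : Prop :=
  independent G I /\ {in I, forall v, low_degree_path v}.

Definition admissible_independent (I : {set V}) : Prop :=
  [/\ low_degree_path_independent I,
      forall J : {set V}, low_degree_path_independent J -> I \subset J -> J = I
    & {in I & vertices G, forall v w, ~ proper_subgraph (F w) (F v)}].

Definition substantial (I : {set V}) (x : T) : Prop :=
  x \in vertices T0 /\
  ((exists v, v \in I /\ endvertex (F v) x) \/ 3 <= degree T0 x).

End IPaths.

(* Main.v *)
Require Import Defs.
From mathcomp Require Import all_boot.

(** If [F v] has no vertex of degree at least 3 in [T0], it is a tree of maximum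
    degree at most 2, hence a path.  So either [v] is in [I], or by maximality
    of [I] the path [F v] meets an [I]-path [F u].  An inner vertex of [F u] has
    degree 2 both in [F u] and in [T0], so [F v] can only leave [F u] through an
    endvertex of [F u]; if it avoided both endvertices, it would be a proper
    subgraph of [F u], contrary to the choice of [I]. *)

Lemma connect_invariant {T : finType} (e : rel T) (P : T -> Prop) (x y : T) :
  (forall a b, e a b -> P a -> P b) -> connect e x y -> P x -> P y.
Proof.
move=> eP /connectP[p e_p ->]; elim: p x e_p => //= z p IHp x /andP[exz e_p] Px.
exact: IHp e_p (eP _ _ exz Px).
Qed.

(** Turns the [zip] encoding of edges in [path_along] into a splitting of the list: for
    [s = x :: p], [behead s] is [p]. *)
Lemma mem_zip_behead {T : eqType} (s : seq T) (y z : T) :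
  reflect (exists s1 s2, s = s1 ++ [:: y, z & s2]) ((y, z) \in zip s (behead s)).
Proof.
apply: (iffP idP) => [|[s1 [s2 ->]]]; last first.
  elim: s1 => [|a s1 IHs1] /=; first by rewrite mem_head.
  by case: s1 IHs1 => [|b s1] /= IHs1; rewrite in_cons IHs1 orbT.
elim: s => // a [//|b s] IHs /=; rewrite in_cons => /predU1P[[-> ->]|].
  by exists [::], s.
by move=> /IHs[s1 [s2 ->]]; exists (a :: s1), s2.
Qed.

Lemma mem_split {T : eqType} (s : seq T) (y : T) :
  y \in s -> exists s1 s2, s = s1 ++ y :: s2.
Proof. by case/splitPr=> s1 s2; exists s1, s2. Qed.

Section Graphs.
Variable T : finType.
Implicit Types (H K : graph T) (s : seq T).

Lemma adj_vertices_r {H x y} : adj H x y -> y \in vertices H.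
Proof. by rewrite (adj_sym H) => /adj_vertices. Qed.

Lemma degree_subgraph {H K} x : subgraph H K -> degree H x <= degree K x.
Proof.
by move=> [_ sHK]; apply/subset_leq_card/subsetP=> y; rewrite !inE; apply: sHK.
Qed.

Lemma adj_degree2 {H y a b z} : degree H y <= 2 -> a != b ->
  adj H y a -> adj H y b -> adj H y z -> (z == a) || (z == b).
Proof.
move=> deg2 neq_ab ya yb yz; rewrite leqNgt in deg2; apply: contraNT deg2.
rewrite negb_or => /andP[neq_za neq_zb].
have U : uniq [:: z; a; b] by rewrite /= !inE negb_or neq_za neq_zb neq_ab.
rewrite -[3]/(size [:: z; a; b]) -(card_uniqP U); apply/subset_leq_card/subsetP.
by move=> w; rewrite !inE => /or3P[] /eqP->.
Qed.

Lemma path_graph_adj {H x p y z} : path_along H x p ->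
  (y, z) \in zip (x :: p) p -> adj H y z.
Proof. by case=> _ _ -> ->. Qed.

(** The predecessor and the successor of an inner vertex are two distinct neighbours in [H], hence
    in [K]; the degree bound leaves no room in [K] for a third. *)
Lemma path_inner_adj {H K x p y z} : path_along H x p -> subgraph H K ->
  y \in vertices H -> degree K y <= 2 -> y != x -> y != last x p ->
  adj K y z -> adj H y z.
Proof.
move=> Hp [_ sHK] yH degy yx yl yz; have [U VH _] := Hp; rewrite VH in yH.
have [s1 [s2 Es]] := mem_split _ _ yH.
case/lastP: s1 Es => [[Ex _]|s1 a Es]; first by rewrite Ex eqxx in yx.
case: s2 Es => [Es|b s2].
  by case/eqP: yl; rewrite -[last x p]/(last x (x :: p)) Es last_cat.
rewrite cat_rcons => Es.
have ya : adj H y a.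
  rewrite (adj_sym H); apply: path_graph_adj Hp _.
  by apply/(mem_zip_behead (x :: p)); exists s1, (b :: s2).
have yb : adj H y b.
  apply: path_graph_adj Hp _; apply/(mem_zip_behead (x :: p)).
  by exists (rcons s1 a), s2; rewrite cat_rcons.
have ab : a != b.
  by move: U; rewrite Es cat_uniq /= !inE !negb_or => /and5P[_ _ /and3P[]].
by have /orP[/eqP->|/eqP->] := adj_degree2 degy ab (sHK _ _ ya) (sHK _ _ yb) yz.
Qed.

(** Duplicate-free lists have length at most [#|T|], so a maximum exists; [[:: x0]] makes it
    positive. *)
Lemma longest_path {H} {x0 : T} : x0 \in vertices H ->
  exists s, [/\ s != [::], {subset s <= vertices H}, sorted (adj H) s, uniq s
    & forall s', {subset s' <= vertices H} -> sorted (adj H) s' -> uniq s' ->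
      size s' <= size s].
Proof.
move=> x0H; pose P n := [exists t : n.-tuple T,
  [&& all (mem (vertices H)) t, sorted (adj H) t & uniq t]].
have P1 : P 1 by apply/existsP; exists [tuple x0]; rewrite /= x0H.
have PT n : P n -> n <= #|T|.
  case/existsP=> t /and3P[_ _ /card_uniqP].
  by rewrite size_tuple => <-; apply: max_card.
have exP : exists n, P n by exists 1.
case: (ex_maxnP exP PT) => n /existsP[t /and3P[/allP tH t_path U]] n_max.
exists t; split=> // [|s /allP sH s_path s_uniq].
  by rewrite -size_eq0 size_tuple -lt0n n_max.
rewrite size_tuple n_max //; apply/existsP; exists (in_tuple s).
by rewrite /= s_path sH.
Qed.

(* A chord would close a cycle of length at least 3. *)
Lemma acyclic_path_consecutive {H s1 s2 s3 y z} : acyclic H ->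
  sorted (adj H) (s1 ++ y :: s2 ++ z :: s3) ->
  uniq (s1 ++ y :: s2 ++ z :: s3) -> adj H y z -> s2 = [::].
Proof.
move=> acH; rewrite -cat_cons -cat_rcons => /cat_sorted2[_ /cat_sorted2[s_path _]].
rewrite !cat_uniq => /and3P[_ _ /and3P[s_uniq _ _]] yz.
have /acH : ucycle (adj H) (rcons (y :: s2) z).
  rewrite /ucycle s_uniq andbT /= rcons_path last_rcons (adj_sym H z) yz andbT.
  exact: s_path.
by rewrite size_rcons /=; case: s2 {s_path s_uniq}.
Qed.

(** A longest path contains all neighbours of its vertices, so by connectedness it spans [H];
    acyclicity then rules out chords. *)
Lemma tree_degree2_is_path {H} :
  is_tree H -> {in vertices H, forall x, degree H x <= 2} -> is_path H.
Proof.
move=> [[/set0Pn[x0 x0H] conH] acH] deg2.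
have [[|x p] [] // _ sH s_path s_uniq s_max] := longest_path x0H.
have s_closed y z : adj H y z -> y \in x :: p -> z \in x :: p.
  move=> yz ys; apply: contraT => zNs; have zH := adj_vertices_r yz.
  have [s1 [s2 Es]] := mem_split _ _ ys.
  (* Stated up to permutation, to cover both ways of extending the path by [z]: in front if [y]
     comes first, at the back if [y] comes last. *)
  have no_longer s : perm_eq s (z :: x :: p) -> ~~ sorted (adj H) s.
    move=> s_perm; apply/negP=> s_sorted.
    have /s_max : {subset s <= vertices H}.
      by move=> w; rewrite (perm_mem s_perm) in_cons => /predU1P[->|/sH].
    rewrite s_sorted (perm_uniq s_perm) (perm_size s_perm) /= ltnn zNs.
    by move/(_ isT s_uniq).
  case/lastP: s1 Es => [|s1 a] Es.
    have /negP[] := no_longer (z :: x :: p) (perm_refl _).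
    by case: Es s_path => -> _ /= ->; rewrite (adj_sym H) yz.
  case: s2 Es => [|b s2] Es.
    have /negP[] := no_longer (rcons (x :: p) z) (introT permPl (perm_rcons _ _)).
    move: s_path; rewrite /= rcons_path => ->.
    by rewrite -[last x p]/(last x (x :: p)) Es last_cat.
  rewrite cat_rcons in Es; rewrite Es in s_path s_uniq.
  (* Here [y] is inner, with distinct path neighbours [a] and [b]; the degree bound forces [z] to be
     one of them, although [z] is off the path. *)
  have /cat_sorted2[_ /and3P[ay yb _]] := s_path.
  rewrite (adj_sym H) in ay.
  have ab : a != b.
    by move: s_uniq; rewrite cat_uniq /= !inE !negb_or => /and5P[_ _ /and3P[]].
  have := adj_degree2 (deg2 _ (adj_vertices yz)) ab ay yb yz.
  by case/orP=> /eqP z_eq; case/negP: zNs; rewrite Es z_eq mem_cat !inE eqxx !orbT.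
(* Only the case of [y] preceding [z] is treated; symmetry of adjacency gives the other. *)
have consecutive y z s1 s2 : x :: p = s1 ++ y :: s2 -> z \in s2 ->
    adj H y z -> (y, z) \in zip (x :: p) p.
  move=> Es /mem_split[s3 [s4 Es2]] yz; rewrite Es2 in Es.
  rewrite Es in s_path s_uniq.
  have s3_nil := acyclic_path_consecutive acH s_path s_uniq yz.
  by apply/(mem_zip_behead (x :: p)); exists s1, s4; rewrite Es s3_nil.
have zip_adj y z : (y, z) \in zip (x :: p) p -> adj H y z.
  case/(mem_zip_behead (x :: p))=> s1 [s2 Es]; rewrite Es in s_path.
  by have /cat_sorted2[_ /andP[]] := s_path.
have VH : vertices H =i x :: p.
  move=> y; apply/idP/idP=> [yH|]; last exact: sH.
  apply: (connect_invariant _ (fun w => w \in x :: p) _ _ s_closed _ (mem_head x p)).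
  by apply: conH => //; apply: sH; apply: mem_head.
exists x, p; split=> // y z; apply/idP/orP=> [yz|[]/zip_adj //]; last first.
  by rewrite (adj_sym H).
have ys : y \in x :: p by rewrite -VH (adj_vertices yz).
have zs : z \in x :: p by rewrite -VH (adj_vertices_r yz).
have [s1 [s2 Es]] := mem_split _ _ ys.
have : z \in s1 ++ y :: s2 by rewrite -Es.
rewrite mem_cat in_cons => /or3P[zs1|/eqP zy|zs2].
- right; have [s3 [s4 Es1]] := mem_split _ _ zs1.
  apply: (consecutive z y s3 (s4 ++ y :: s2)).
  + by rewrite Es Es1 -catA.
  + by rewrite mem_cat mem_head orbT.
  + by rewrite (adj_sym H).
- by rewrite zy adj_irrefl in yz.
- by left; apply: consecutive Es zs2 yz.
Qed.

End Graphs.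

Theorem proposition2p1 (V T : finType) (G : graph V) (T0 : graph T)
    (F : V -> graph T) (I : {set V}) :
  chordal G ->
  minimum_tree_representation G T0 F ->
  admissible_independent G T0 F I ->
  forall v : V, v \in vertices G ->
    exists x : T, x \in vertices (F v) /\ substantial T0 F I x.
Proof.
move=> _ [[_ FT FG] _] [[[IG Iind] Ilow] Imax Imin] v vG.
have [Fv_tree [sFv aFv]] := FT v vG.
have [/exists_inP[x xFv degx]|/exists_inPn low] :=
    boolP [exists x in vertices (F v), 2 < degree T0 x].
  by exists x; split=> //; split; [exact: (subsetP sFv)|right].
have degFv : {in vertices (F v), forall x, degree T0 x <= 2}.
  by move=> x /low; rewrite -leqNgt.
have endI u x : u \in I -> endvertex (F u) x -> x \in vertices (F v) ->
    exists y, y \in vertices (F v) /\ substantial T0 F I y.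
  move=> uI xFu xFv; exists x; split=> //; split; first exact: (subsetP sFv).
  by left; exists u.
have [vI|vNI] := boolP (v \in I).
  have [[x [p xp]] _] := Ilow v vI.
  apply: (endI v x vI); first by exists x, p; split; [|left].
  by case: xp => _ -> _; apply: mem_head.
have [/exists_inP[u uI uv]|/exists_inPn noadj] :=
    boolP [exists u in I, adj G u v]; last first.
  (* With no neighbour of [v] in [I], the set [v |: I] is again a candidate, so maximality puts [v]
     in [I]. *)
  case/negP: vNI; rewrite -(Imax (v |: I)) ?setU11 ?subsetUr //.
  split; first split.
  - by rewrite subUset sub1set vG.
  - move=> a b; rewrite !in_setU1 => /predU1P[->|aI] /predU1P[->|bI].
    + by rewrite adj_irrefl.
    + by rewrite (adj_sym G) noadj.
    + exact: noadj.
    + exact: Iind.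
  move=> w; rewrite in_setU1 => /predU1P[->|/Ilow //]; split=> //.
  apply: tree_degree2_is_path => // x xFv.
  by apply: leq_trans (degFv x xFv); apply: degree_subgraph.
have uG := subsetP IG u uI; have [_ sFu] := FT u uG.
have neq_uv : u != v by apply: contraTneq uv => ->; rewrite adj_irrefl.
have [x0 [x0u x0v]] := (FG u v uG vG neq_uv).1 uv.
have [[x [p xp]] _] := Ilow u uI.
have [xFv|xNFv] := boolP (x \in vertices (F v)).
  by apply: (endI u x) => //; exists x, p; split; [|left].
have [lFv|lNFv] := boolP (last x p \in vertices (F v)).
  by apply: (endI u (last x p)) => //; exists x, p; split; [|right].
(* Both ends of [F u] avoid [F v], so any common vertex is inner in [F u], and its [T0]-edges all
   belong to [F u]. *)
have stay y z : y \in vertices (F u) -> adj (F v) y z -> adj (F u) y z.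
  move=> yFu yz; have yFv := adj_vertices yz.
  have yx : y != x by apply: contraNneq xNFv => <-.
  have yl : y != last x p by apply: contraNneq lNFv => <-.
  exact: path_inner_adj xp sFu yFu (degFv y yFv) yx yl (aFv _ _ yz).
(* Connectedness of [F v] spreads membership in [F u] from the common vertex [x0]. *)
have sub y : y \in vertices (F v) -> y \in vertices (F u).
  move=> yFv; have x0y := Fv_tree.1.2 x0 y x0v yFv.
  apply: (connect_invariant _ (fun w => w \in vertices (F u)) _ _ _ x0y x0u).
  by move=> a b ab aFu; apply: adj_vertices_r (stay a b aFu ab).
(* The inclusion of [F v] in [F u] is proper because the end [x] of [F u] is not in [F v]. *)
case: (Imin u v uI vG); split.
  split; first exact/subsetP.
  by move=> y z yz; apply: stay => //; apply/sub/(adj_vertices yz).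
case=> /subsetP sFuv _; case/negP: xNFv; apply: sFuv.
by case: xp => _ -> _; apply: mem_head.
Qed.
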